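(* There is a constant $c>0$ such that for every positive integer $r$ there exist a finite biclique and a spanning partition of it into $r$ bi-equivalence graphs $G_1,\dots,G_r$ such that each $G_i$ has width at least $c\,r^{3/2}$.
   Context: A biclique $[X,Y]$ is a complete bipartite graph with nonempty vertex classes $X$ and $Y$. A bi-equivalence graph is a graph each of whose connected components is a biclique. A partition of a biclique $G$ into bi-equivalence graphs $G_1,\dots,G_r$ means that every edge of $G$ belongs to exactly one $G_i$, each $G_i$ being a bi-equivalence graph. The partition is spanning if every vertex of $G$ is incident with at least one edge of each $G_i$. The width of $G_i$ is the number of its connected components. *)

(* Defs.v *)
From mathcomp Require Import all_boot.
Set Implicit Arguments.
Unset Strict Implicit.
Unset Printing Implicit Defensive.

(* The vertex set is a field of the graph, so that a subgraph may omit
   vertices and distinct graphs on the same type can be compared. *)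
Record sgraph (T : finType) := SGraph {
  vset : {set T};
  adj : rel T;
  adj_sym : symmetric adj;
  adj_irrefl : irreflexive adj;
  adj_vset : forall x y, adj x y -> x \in vset
}.

Section Graphs.
Variable T : finType.
Implicit Types (G H : sgraph T) (X Y A : {set T}).

Definition biclique_on G X Y : Prop :=
  [/\ X != set0, Y != set0, [disjoint X & Y], vset G = X :|: Y
    & forall x y, adj G x y =
        ((x \in X) && (y \in Y)) || ((x \in Y) && (y \in X))].

Definition biclique G : Prop := exists X Y, biclique_on G X Y.

Definition induced_adj G A : rel T :=
  fun x y => [&& x \in A, y \in A & adj G x y].

Lemma induced_adj_sym G A : symmetric (induced_adj G A).
Proof. by move=> x y; rewrite /induced_adj adj_sym andbCA. Qed.

Lemma induced_adj_irrefl G A : irreflexive (induced_adj G A).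
Proof. by move=> x; rewrite /induced_adj adj_irrefl !andbF. Qed.

Lemma induced_adj_vset G A x y :
  induced_adj G A x y -> x \in vset G :&: A.
Proof. by case/and3P=> xA _ /adj_vset xG; rewrite inE xG. Qed.

Definition induced G A : sgraph T :=
  SGraph (@induced_adj_sym G A) (@induced_adj_irrefl G A)
         (@induced_adj_vset G A).

Definition component G (x : T) : sgraph T :=
  induced G [set y | connect (adj G) x y].

Definition bi_equivalence G : Prop :=
  forall x, x \in vset G -> biclique (component G x).

Definition width G : nat := n_comp (adj G) (vset G).

Definition subgraph H G : Prop :=
  vset H \subset vset G /\ (forall x y, adj H x y -> adj G x y).

Definition bi_equivalence_partition G (r : nat) (H : 'I_r -> sgraph T) : Prop :=
  [/\ forall i, subgraph (H i) G,
      forall i, bi_equivalence (H i)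
    & forall x y, adj G x y -> exists! i, adj (H i) x y].

Definition spanning_family G (r : nat) (H : 'I_r -> sgraph T) : Prop :=
  forall x, x \in vset G -> forall i, exists y, adj (H i) x y.

End Graphs.

(* Main.v *)
Require Import Defs.
From HB Require Import structures.
From mathcomp Require Import all_boot all_order all_algebra.
From mathcomp Require Import reals exp.
From mathcomp Require Import zify.
Set Implicit Arguments.
Unset Strict Implicit.
Unset Printing Implicit Defensive.
Import Order.TTheory GRing.Theory Num.Theory.
Local Open Scope ring_scope.

(* A spanning partition of [K_{X,Y}] into bi-equivalence graphs [H_i] amounts to
   assigning to each vertex a word indexed by the [i]'s, its letter at [i] being
   its component in [H_i]: each word of [X] agrees with each word of [Y] at
   exactly one position, and at each position both sides use the same letters.

   The four words 00, 11 (in [X]) and 01, 10 (in [Y]) form such a system, and one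
   may replace each of the two letters at each of its two positions by a system
   of its own.  Two systems substituted for the two letters of the same position
   must have the same number of positions, but not the same widths, and their
   widths add up.  Substituting at one position only gives widths at least
   1, 2, 4, ..., 2^n.  Substituting this system and its reverse for the two
   letters of each position gives widths 2^k + 2^(n-k), which exceed r^2 / 32. *)

(** * Word systems and the widths they realize *)

Local Open Scope nat_scope.

(** [lword0] and [rword0] keep both sides nonempty, as a biclique requires, and later serve as
    padding. *)
Record word_system (I : finType) := WordSystem {
  lword : finType;
  rword : finType;
  letter : finType;
  lword0 : lword;
  rword0 : rword;
  lletter : I -> lword -> letter;
  rletter : I -> rword -> letter;
  agree_once : forall x y, exists! i, lletter i x = rletter i y;
  lletter_used : forall i x, exists y, lletter i x = rletter i y;
  rletter_used : forall i y, exists x, lletter i x = rletter i y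
}.

(** By [lletter_used] and [rletter_used], the right words have the same letters at [i]. *)
Definition letters (I : finType) (s : word_system I) (i : I) : {set letter s} :=
  [set lletter i x | x in lword s].

Definition realizable (I : finType) (w : I -> nat) : Prop :=
  exists s : word_system I, forall i, w i <= #|letters s i|.

Lemma realizable_leq (I : finType) (w w' : I -> nat) :
  (forall i, w' i <= w i) -> realizable w -> realizable w'.
Proof.
by move=> le_w [s ws]; exists s => i; apply: leq_trans (le_w i) (ws i).
Qed.

Lemma realizable_reindex (I J : finType) (h : J -> I) (w : I -> nat) :
  bijective h -> realizable w -> realizable (w \o h).
Proof.
move=> [h' hK h'K] [s ws].
have once x y : exists! j, lletter (h j) x = rletter (w := s) (h j) y.
  have [i [fg uniq_i]] := agree_once x y.
  exists (h' i); split; first by rewrite h'K.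
  by move=> j /uniq_i->.
exists (WordSystem (lword0 s) (rword0 s) once
         (fun j => @lletter_used _ s (h j)) (fun j => @rletter_used _ s (h j))).
by move=> j; apply: ws.
Qed.

Lemma realizable_unit : realizable (fun _ : unit => 1).
Proof.
have once (x y : unit) : exists! i : unit, tt = tt by exists tt; split=> // -[].
have used (i x : unit) : exists y : unit, tt = tt by exists tt.
exists (WordSystem tt tt once used used) => i.
by rewrite card_gt0; apply/set0Pn; exists tt; apply/imsetP; exists tt.
Qed.

Lemma leq_card_sum (U V W : finType) (h : U + V -> W)
    (A : {set U}) (B : {set V}) (C : {set W}) :
    injective h -> {in A, forall a, h (inl a) \in C} ->
    {in B, forall b, h (inr b) \in C} ->
  #|A| + #|B| <= #|C|.
Proof.
move=> h_inj hA hB.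
have inl_inj : injective (h \o inl) by move=> a a' /h_inj [].
have inr_inj : injective (h \o inr) by move=> b b' /h_inj [].
have disj : (h \o inl) @: A :&: (h \o inr) @: B = set0.
  apply/setP=> z; rewrite !inE; apply/andP=> -[/imsetP[a _ ->] /imsetP[b _]].
  by move/h_inj.
rewrite -(card_imset A inl_inj) -(card_imset B inr_inj) -cardsUI disj cards0 addn0.
apply/subset_leq_card/subsetP=> z /setUP[] /imsetP[u uin ->]; [exact: hA | exact: hB].
Qed.

(** * Substituting four systems into the words 00, 11, 01, 10 *)

Section Combine.
Variables (I J : finType) (s s' : word_system I) (t t' : word_system J).

(** [s], [s'] replace the letters 0, 1 of the first position and [t], [t'] those of the second. The
    summands of [X] stand for 00 and 11, those of [Y] for 01 and 10. *)
Let X := (lword s * lword t + lword s' * lword t')%type.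
Let Y := (rword s * rword t' + rword s' * rword t)%type.
Let S := ((letter s + letter s') + (letter t + letter t'))%type.

Definition combine_l (k : I + J) (x : X) : S :=
  match k, x with
  | inl i, inl (a, _) => inl (inl (lletter i a))
  | inl i, inr (a, _) => inl (inr (lletter i a))
  | inr j, inl (_, b) => inr (inl (lletter j b))
  | inr j, inr (_, b) => inr (inr (lletter j b))
  end.

Definition combine_r (k : I + J) (y : Y) : S :=
  match k, y with
  | inl i, inl (a, _) => inl (inl (rletter i a))
  | inl i, inr (a, _) => inl (inr (rletter i a))
  | inr j, inl (_, b) => inr (inr (rletter j b))
  | inr j, inr (_, b) => inr (inl (rletter j b))
  end.

(** The base words behind [x] and [y] agree at one position; there both sides use the same system,
    whose words agree once. At the other position their letters lie in different summands of [S]. *)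
Lemma combine_agree_once x y : exists! k, combine_l k x = combine_r k y.
Proof.
case: x y => [] [a b] [] [c d].
- have [i [fg uniq_i]] := agree_once a c.
  exists (inl i); split=> [|[i'|j'] //=]; first by rewrite /= fg.
  by move=> [/uniq_i->].
- have [j [fg uniq_j]] := agree_once b d.
  exists (inr j); split=> [|[i'|j'] //=]; first by rewrite /= fg.
  by move=> [/uniq_j->].
- have [j [fg uniq_j]] := agree_once b d.
  exists (inr j); split=> [|[i'|j'] //=]; first by rewrite /= fg.
  by move=> [/uniq_j->].
have [i [fg uniq_i]] := agree_once a c.
exists (inl i); split=> [|[i'|j'] //=]; first by rewrite /= fg.
by move=> [/uniq_i->].
Qed.

Lemma combine_l_used k x : exists y, combine_l k x = combine_r k y.
Proof.
case: k x => [i|j] [] [a b].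
(* Only the block containing [k] matters; the other one is padded with a default word. *)
- by have [c ac] := lletter_used i a; exists (inl (c, rword0 t')); rewrite /= ac.
- by have [c ac] := lletter_used i a; exists (inr (c, rword0 t)); rewrite /= ac.
- by have [d bd] := lletter_used j b; exists (inr (rword0 s', d)); rewrite /= bd.
- by have [d bd] := lletter_used j b; exists (inl (rword0 s, d)); rewrite /= bd.
Qed.

Lemma combine_r_used k y : exists x, combine_l k x = combine_r k y.
Proof.
case: k y => [i|j] [] [a b].
- by have [c ac] := rletter_used i a; exists (inl (c, lword0 t)); rewrite /= ac.
- by have [c ac] := rletter_used i a; exists (inr (c, lword0 t')); rewrite /= ac.
- by have [d bd] := rletter_used j b; exists (inr (lword0 s', d)); rewrite /= bd.
- by have [d bd] := rletter_used j b; exists (inl (lword0 s, d)); rewrite /= bd.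
Qed.

Definition combine : word_system (I + J)%type :=
  WordSystem (inl (lword0 s, lword0 t)) (inl (rword0 s, rword0 t'))
    combine_agree_once combine_l_used combine_r_used.

Lemma combine_width_inl i :
  #|letters s i| + #|letters s' i| <= #|letters combine (inl i)|.
Proof.
apply: (leq_card_sum (h := inl)) => [u v [] // | _ /imsetP[a _ ->] | _ /imsetP[a _ ->]];
  apply/imsetP.
  by exists (inl (a, lword0 t)).
by exists (inr (a, lword0 t')).
Qed.

Lemma combine_width_inr j :
  #|letters t j| + #|letters t' j| <= #|letters combine (inr j)|.
Proof.
apply: (leq_card_sum (h := inr)) => [u v [] // | _ /imsetP[b _ ->] | _ /imsetP[b _ ->]];
  apply/imsetP.
  by exists (inl (lword0 s, b)).
by exists (inr (lword0 s', b)).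
Qed.

End Combine.

Lemma realizable_combine (m n : nat) (u u' : 'I_m -> nat) (v v' : 'I_n -> nat) :
    realizable u -> realizable u' -> realizable v -> realizable v' ->
  realizable (fun k : 'I_(m + n) => match split k with
              | inl i => u i + u' i | inr j => v j + v' j end).
Proof.
move=> [s us] [s' us'] [t vt] [t' vt'].
pose w (k : 'I_m + 'I_n) :=
  match k with inl i => u i + u' i | inr j => v j + v' j end.
have rw : realizable w.
  exists (combine s s' t t') => -[i|j] /=.
    by apply: leq_trans (combine_width_inl _ _ _ _ _); apply: leq_add.
  by apply: leq_trans (combine_width_inr _ _ _ _ _); apply: leq_add.
by apply: (realizable_reindex _ rw); exists unsplit; [apply: splitK | apply: unsplitK].
Qed.

(** * Exponential widths and the quadratic bound *)

Lemma realizable_ord1 : realizable (fun _ : 'I_1 => 1).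
Proof.
apply: (@realizable_reindex _ _ (fun _ => tt) _ _ realizable_unit).
by exists (fun _ => ord0) => [i|[]]; rewrite ?ord1.
Qed.

(** One-position systems go into the first position and two copies of the previous system into the
    second: its widths double, and the new width 2 is weakened to 1. *)
Lemma realizable_exp2 n : realizable (fun i : 'I_n.+1 => 2 ^ i).
Proof.
elim: n => [|n IHn].
  by apply: realizable_leq realizable_ord1 => i; rewrite ord1.
have r1 := realizable_ord1.
apply: realizable_leq (realizable_combine r1 r1 IHn IHn) => k.
by case: (split_ordP (k : 'I_(1 + n.+1))) => [i|j] -> /=;
  rewrite ?ord1 // add1n expnS mul2n addnn.
Qed.

Lemma realizable_exp2_rev n : realizable (fun i : 'I_n.+1 => 2 ^ (n - i)).
Proof.
have rev_bij : bijective (@rev_ord n.+1) by exists (@rev_ord n.+1); apply: rev_ordK.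
by apply: realizable_leq (realizable_reindex rev_bij (realizable_exp2 n)) => i /=.
Qed.

Lemma leq_sqrS_exp2 n : n.+1 ^ 2 <= 4 * 2 ^ n.
Proof.
(* The inductive step needs [(m + 1)^2 <= 2 * m^2], which holds only from [m = 3] on; smaller cases
   are computed. *)
elim: n => // -[|[|n]] // IHn; rewrite expnS mulnCA.
by apply: (@leq_trans (2 * n.+3 ^ 2)); [rewrite -!mulnn; nia | rewrite leq_mul2l].
Qed.

(** Write [n + 2] as [(i + 1) + (n - i + 1)] and use [(a + b)^2 <= 2 * (a^2 + b^2)], whence 8 = 2 *
    4. *)
Lemma leq_sqr_exp2D n i : i <= n -> n.+2 ^ 2 <= 8 * (2 ^ i + 2 ^ (n - i)).
Proof.
move=> le_in; have Ei := leq_sqrS_exp2 i; have Eni := leq_sqrS_exp2 (n - i).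
have -> : n.+2 = i.+1 + (n - i).+1 by lia.
have [AGM _] := nat_Cauchy i.+1 (n - i).+1; rewrite sqrnD; lia.
Qed.

Lemma realizable_quadratic r : 0 < r ->
  exists2 w : 'I_r -> nat, realizable w & forall i, r ^ 2 <= 32 * w i.
Proof.
case: r => [|[|r]] // _.
  by exists (fun=> 1) => //; apply: realizable_ord1.
(* Two blocks of nearly equal size, one for each base position. *)
have -> : r.+2 = r./2.+1 + (uphalf r).+1 by lia.
have [F B] := (realizable_exp2, realizable_exp2_rev).
eexists; first exact: realizable_combine (F _) (B _) (F _) (B _).
(* For a block of [n + 1] positions, [r + 2 <= 2 * (n + 2)], even for the shorter block when [r] is
   odd; squaring turns 8 into 32. *)
have le_sqr n E : r <= n.*2.+1 -> n.+2 ^ 2 <= 8 * E ->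
    (r./2.+1 + (uphalf r).+1) ^ 2 <= 32 * E.
  move=> le_rn le_E; apply: (@leq_trans ((2 * n.+2) ^ 2)).
    by rewrite leq_exp2r //; lia.
  by rewrite expnMn; lia.
move=> k; case: split => i /=.
  by apply: (le_sqr r./2); [lia | apply: leq_sqr_exp2D; rewrite -ltnS].
by apply: (le_sqr (uphalf r)); [lia | apply: leq_sqr_exp2D; rewrite -ltnS].
Qed.

(** * From word systems to graphs *)

Section BipartiteGraph.
Variables (X Y : finType) (e : X -> Y -> bool).

Definition bip_adj : rel (X + Y) := fun u v =>
  match u, v with
  | inl x, inr y | inr y, inl x => e x y
  | _, _ => false
  end.

Lemma bip_adj_sym : symmetric bip_adj. Proof. by case=> ? []. Qed.

Lemma bip_adj_irrefl : irreflexive bip_adj. Proof. by case. Qed.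

Lemma bip_adj_vset u v : bip_adj u v -> u \in [set: X + Y].
Proof. by rewrite inE. Qed.

Definition bip_graph : sgraph (X + Y)%type :=
  SGraph bip_adj_sym bip_adj_irrefl bip_adj_vset.

End BipartiteGraph.

Lemma biclique_bip_graph (X Y : finType) (x0 : X) (y0 : Y) :
  biclique (bip_graph (fun (_ : X) (_ : Y) => true)).
Proof.
exists [set inl x | x : X], [set inr y | y : Y].
have inE_l (z : X + Y) : (z \in [set inl x | x : X]) = (if z is inl _ then true else false).
  by apply/imsetP; case: z => [x|y]; [exists x | case].
have inE_r (z : X + Y) : (z \in [set inr y | y : Y]) = (if z is inr _ then true else false).
  by apply/imsetP; case: z => [x|y]; [case | exists y].
split.
- by apply/set0Pn; exists (inl x0); rewrite inE_l.
- by apply/set0Pn; exists (inr y0); rewrite inE_r.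
- by apply/pred0P=> -[z|z]; rewrite /= inE_l inE_r.
- by apply/setP=> z; rewrite in_setU inE_l inE_r inE; case: z.
- by case=> ? [] ?; rewrite ?inE_l ?inE_r.
Qed.

Section FibreGraph.
Variables (X Y S : finType) (f : X -> S) (g : Y -> S).
Hypothesis f_used : forall x, exists y, f x = g y.
Hypothesis g_used : forall y, exists x, f x = g y.

Definition fibre_graph : sgraph (X + Y)%type := bip_graph (fun x y => f x == g y).

Let label (z : X + Y) : S := match z with inl x => f x | inr y => g y end.

Let adj_label u v : adj fibre_graph u v -> label u = label v.
Proof. by case: u v => [x|y] [x'|y'] //= /eqP. Qed.

Lemma fibre_graph_spanning z : exists z', adj fibre_graph z z'.
Proof.
case: z => [x|y].
  by have [y fg] := f_used x; exists (inr y); apply/eqP.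
by have [x fg] := g_used y; exists (inl x); apply/eqP.
Qed.

(** Edges preserve labels. Conversely, equal labels on opposite sides give an edge, and on the same
    side a common neighbour, since the label also occurs on the other side. *)
Lemma fibre_graph_connect u v : connect (adj fibre_graph) u v = (label u == label v).
Proof.
apply/idP/eqP => [/connectP[p pth ->] | eq_uv].
  elim: p u pth => //= z p IHp u /andP[/adj_label-> ]; exact: IHp.
case: u v eq_uv => [x|y] [x'|y'] /= eq_uv.
- have [y fg] := f_used x; apply: (@connect_trans _ _ (inr y)); apply: connect1.
    by rewrite /= fg.
  by rewrite /= -eq_uv fg.
- by apply: connect1; rewrite /= eq_uv.
- by apply: connect1; rewrite /= eq_uv.
- have [x fg] := g_used y; apply: (@connect_trans _ _ (inl x)); apply: connect1.
    by rewrite /= fg.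
  by rewrite /= fg eq_uv.
Qed.

Lemma fibre_graph_bi_equivalence : bi_equivalence fibre_graph.
Proof.
move=> z _.
have [[x fx] [y gy]] : (exists x, f x = label z) /\ (exists y, g y = label z).
  case: z => [x|y] /=.
    by have [y fg] := f_used x; split; [exists x | exists y].
  by have [x fg] := g_used y; split; [exists x | exists y].
set s := label z in fx gy.
have inl_inj : injective (@inl X Y) by move=> ? ? [].
have inr_inj : injective (@inr X Y) by move=> ? ? [].
(* The classes are the two fibres over the label of [z]. *)
exists (inl @: [set x | f x == s]), (inr @: [set y | g y == s]).
have in_l (u : X + Y) : (u \in inl @: [set x | f x == s]) =
    (if u is inl x then f x == s else false).
  case: u => [x'|y']; first by rewrite mem_imset // inE.
  by apply/imsetP=> -[].
have in_r (u : X + Y) : (u \in inr @: [set y | g y == s]) =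
    (if u is inr y then g y == s else false).
  case: u => [x'|y']; last by rewrite mem_imset // inE.
  by apply/imsetP=> -[].
split.
- by apply/set0Pn; exists (inl x); rewrite in_l fx.
- by apply/set0Pn; exists (inr y); rewrite in_r gy.
- by apply/pred0P=> -[u|u]; rewrite /= in_l in_r ?andbF.
- apply/setP=> u; rewrite in_setU in_l in_r !inE fibre_graph_connect -/s eq_sym.
  by case: u => u; rewrite ?orbF.
move=> u v; rewrite /= /induced_adj !inE !fibre_graph_connect -/s !in_l !in_r.
rewrite ![s == _]eq_sym.
case: u v => [u|u] [v|v] /=; rewrite ?andbF ?orbF //.
  by apply/and3P/andP=> -[/eqP-> /eqP-> //]; rewrite eqxx.
by apply/and3P/andP=> -[/eqP-> /eqP-> //]; rewrite eqxx.
Qed.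

(** The root of the component of [inl x] carries the label [f x], so every letter is the label of
    some root. *)
Lemma fibre_graph_width : #|[set f x | x : X]| <= width fibre_graph.
Proof.
have csym : connect_sym (adj fibre_graph).
  by move=> u v; rewrite !fibre_graph_connect eq_sym.
pose reps := [set u | roots (adj fibre_graph) u].
apply: (@leq_trans #|label @: reps|).
  apply/subset_leq_card/subsetP=> _ /imsetP[x _ ->]; apply/imsetP.
  exists (fingraph.root (adj fibre_graph) (inl x)); first by rewrite inE roots_root.
  by have := connect_root (adj fibre_graph) (inl x); rewrite fibre_graph_connect => /eqP.
apply: leq_trans (leq_imset_card _ _) _.
by apply/subset_leq_card/subsetP=> u; rewrite !inE andbT.
Qed.

End FibreGraph.

Lemma word_system_partition (r : nat) (s : word_system 'I_r) :
  exists (T : finType) (G : sgraph T) (H : 'I_r -> sgraph T),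
    [/\ biclique G, bi_equivalence_partition G H, spanning_family G H
      & forall i, #|letters s i| <= width (H i)].
Proof.
pose H i := fibre_graph (@lletter _ s i) (@rletter _ s i).
exists _, (bip_graph (fun (_ : lword s) (_ : rword s) => true)), H.
have lu := @lletter_used _ s; have ru := @rletter_used _ s.
split.
- exact: biclique_bip_graph (lword0 s) (rword0 s).
- split=> [i||].
  + by split=> [|[x|y] [x'|y']] /=; rewrite ?subsetT.
  + by move=> i; apply: fibre_graph_bi_equivalence.
  have once x y : exists! i, lletter i x == rletter (w := s) i y.
    have [i [fg uniq_i]] := agree_once x y.
    by exists i; split=> [|j /eqP]; [apply/eqP | apply: uniq_i].
  by case=> [x|y] [x'|y'] //= _; apply: once.
- by move=> z _ i; apply: fibre_graph_spanning.
by move=> i; apply: fibre_graph_width.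
Qed.

Local Open Scope ring_scope.

Theorem theorem4 (R : realType) :
  exists c : R, 0 < c /\
    forall r : nat, (0 < r)%N ->
      exists (T : finType) (G : sgraph T) (H : 'I_r -> sgraph T),
        [/\ biclique G,
            bi_equivalence_partition G H,
            spanning_family G H
          & forall i : 'I_r,
              c * (r%:R `^ (3%:R / 2%:R)) <= (width (H i))%:R].
Proof.
exists (32%:R^-1); split=> [|r r_gt0]; first by rewrite invr_gt0 ltr0n.
have [w [s ws] w_ge] := realizable_quadratic r_gt0.
have [T [G [H [bG pGH sGH wH]]]] := word_system_partition s.
exists T, G, H; split=> // i.
rewrite mulrC ler_pdivrMr ?ltr0n //.
(* Since [1 <= r], the power with exponent 3/2 is at most [r ^ 2], so the quadratic bound
   suffices. *)
apply: (@le_trans _ _ ((r ^ 2)%:R)); last first.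
  rewrite -natrM ler_nat mulnC.
  by apply: leq_trans (w_ge i) _; rewrite leq_mul2l (leq_trans (ws i)).
rewrite natrX -powR_mulrn ?ler0n //; apply: ler_powR; first by rewrite ler1n.
by rewrite ler_pdivrMr ?ltr0n // -natrM ler_nat.
Qed.
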